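(* There is a residual (dense $G_\delta$) subset of $C_\lambda(I)$ all of whose elements have both the shadowing property and the periodic shadowing property.
   Context: $I=[0,1]$, $\lambda$ is Lebesgue measure, $d$ the Euclidean distance on $I$. $C_\lambda(I)$ is the set of continuous maps $f\colon I\to I$ preserving $\lambda$, with the uniform metric $\rho(f,g)=\sup_{x}|f(x)-g(x)|$. For $\delta>0$, a sequence $(x_n)_{n\ge0}\subset I$ is a $\delta$-pseudo orbit of $f$ if $d(f(x_n),x_{n+1})<\delta$ for all $n\ge0$; it is periodic if there is $N\ge1$ with $x_{n+N}=x_n$ for all $n$. A point $x$ $\varepsilon$-traces $(y_n)$ if $d(f^n(x),y_n)<\varepsilon$ for all $n\ge0$. $f$ has the shadowing property if for every $\varepsilon>0$ there is $\delta>0$ such that every $\delta$-pseudo orbit is $\varepsilon$-traced by some point of $I$; $f$ has the periodic shadowing property if for every $\varepsilon>0$ there is $\delta>0$ such that every periodic $\delta$-pseudo orbit is $\varepsilon$-traced by some periodic point of $f$. *)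

(* Defs.v *)
From HB Require Import structures.
From mathcomp Require Import all_boot all_order all_algebra.
From mathcomp Require Import all_classical all_reals all_analysis.
Set Implicit Arguments. Unset Strict Implicit. Unset Printing Implicit Defensive.
Import Order.TTheory GRing.Theory Num.Theory.
Import numFieldNormedType.Exports.
Local Open Scope classical_set_scope.
Local Open Scope ring_scope.

Section Defs.
Variable R : realType.

Definition I01 : set R := `[0, 1]%classic.

(* C_lambda(I): continuous self-maps of I preserving Lebesgue measure.
   Maps are represented as functions R -> R; only their values on I matter. *)
Definition C_lambda : set (R -> R) :=
  [set f | {within I01, continuous f} /\ (forall x, I01 x -> I01 (f x)) /\
     (forall A : set R, measurable A -> A `<=` I01 ->
        (@lebesgue_measure R) (I01 `&` f @^-1` A) = (@lebesgue_measure R) A)].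

Definition rho (f g : R -> R) : R := sup [set `|f x - g x| | x in I01].

Definition open_in_Cl (U : set (R -> R)) : Prop :=
  U `<=` C_lambda /\
  forall f, U f -> exists2 e : R, 0 < e &
    forall g, C_lambda g -> rho f g < e -> U g.

Definition dense_in_Cl (U : set (R -> R)) : Prop :=
  forall f, C_lambda f -> forall e : R, 0 < e ->
    exists2 g, U g & rho f g < e.

Definition residual_in_Cl (G : set (R -> R)) : Prop :=
  G `<=` C_lambda /\
  exists U : nat -> set (R -> R),
    (forall n, open_in_Cl (U n)) /\ (forall n, dense_in_Cl (U n)) /\
    \bigcap_n U n `<=` G.

Definition pseudo_orbit (f : R -> R) (delta : R) (x : nat -> R) : Prop :=
  (forall n, I01 (x n)) /\ (forall n, `|f (x n) - x n.+1| < delta).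

Definition periodic_seq (x : nat -> R) : Prop :=
  exists2 N : nat, (1 <= N)%N & forall n, x (n + N)%N = x n.

Definition traces (f : R -> R) (eps : R) (z : R) (y : nat -> R) : Prop :=
  forall n, `|iter n f z - y n| < eps.

Definition periodic_point (f : R -> R) (z : R) : Prop :=
  I01 z /\ exists2 N : nat, (1 <= N)%N & iter N f z = z.

Definition shadowing (f : R -> R) : Prop :=
  forall eps : R, 0 < eps -> exists2 delta : R, 0 < delta &
    forall x, pseudo_orbit f delta x -> exists2 z, I01 z & traces f eps z x.

Definition periodic_shadowing (f : R -> R) : Prop :=
  forall eps : R, 0 < eps -> exists2 delta : R, 0 < delta &
    forall x, pseudo_orbit f delta x -> periodic_seq x ->
      exists2 z, periodic_point f z & traces f eps z x.

End Defs.

(* Main.v *)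
(** Call [eps]-robust a map f of C_lambda(I) for which every point x of I has a
    window K_x within eps of x, such that f(K_x) covers K_y with a uniform
    margin delta as soon as |f(x) - y| < delta.  Robust maps form an open set,
    and along a delta-pseudo orbit each window covers the next one under f, so
    that nested intervals (resp. the intermediate value theorem applied to
    f^N - id, for a periodic pseudo orbit) give an eps-tracing (periodic) point.

    Density: replace f by g = h2 o h1 o f o h, where h, h1, h2 are measure
    preserving zigzags close to the identity.  Fix a partition of I into short
    intervals W_i, each with a tiny central interval K_i.  The map h folds so
    often that h(K_i) = W_i, hence g(K_i) = g(W_i).  The map h1 folds so often
    that each h1(f(W_i)), a nondegenerate interval, has its end points on a
    fixed grid.  That grid is shifted with respect to the windows of the
    three-lap zigzag h2, so that the minimum of g on W_i lies in some W_j below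
    K_j and the maximum in some W_j above K_j.  Hence g(K_i) covers K_j with
    a margin whenever g(W_i) comes close to W_j. *)

Require Import Defs.
From HB Require Import structures.
From mathcomp Require Import all_boot all_order all_algebra.
From mathcomp Require Import all_classical all_reals all_analysis.
From mathcomp Require Import measurable_realfun ring lra.
Set Implicit Arguments. Unset Strict Implicit. Unset Printing Implicit Defensive.
Import Order.TTheory GRing.Theory Num.Theory.
Import numFieldNormedType.Exports.
Local Open Scope classical_set_scope.
Local Open Scope ring_scope.

(** * Zigzags preserve Lebesgue measure *)

Section ZigzagMeasure.
Variable R : realType.
Notation mu := (@lebesgue_measure R).

(* Three laps of slopes 3, -3, 3 on [w, w + 3d], the identity elsewhere. *)
Definition zigzag (w d x : R) : R :=
  x + `|x - w| - 3 * `|x - (w + d)| + 3 * `|x - (w + 2 * d)|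
    - `|x - (w + 3 * d)|.

Lemma zigzag_out (w d x : R) : 0 < d ->
  x <= w \/ w + 3 * d <= x -> zigzag w d x = x.
Proof.
move=> d0 [xw|xw]; rewrite /zigzag.
- by rewrite !ler0_norm; lra.
- by rewrite !ger0_norm; lra.
Qed.

Lemma zigzag_lap1 (w d x : R) : 0 < d ->
  w <= x <= w + d -> zigzag w d x = 3 * x - 2 * w.
Proof.
move=> d0 /andP[xw xd]; rewrite /zigzag (@ger0_norm _ (x - w)); last lra.
by rewrite !ler0_norm; lra.
Qed.

Lemma zigzag_lap2 (w d x : R) : 0 < d ->
  w + d <= x <= w + 2 * d -> zigzag w d x = - (3 * x) + (4 * w + 6 * d).
Proof.
move=> d0 /andP[xw xd]; rewrite /zigzag (@ger0_norm _ (x - w)); last lra.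
rewrite (@ger0_norm _ (x - (w + d))); last lra.
by rewrite !ler0_norm; lra.
Qed.

Lemma zigzag_lap3 (w d x : R) : 0 < d ->
  w + 2 * d <= x <= w + 3 * d -> zigzag w d x = 3 * x + (- (2 * w) - 6 * d).
Proof.
move=> d0 /andP[xw xd]; rewrite /zigzag (@ler0_norm _ (x - (w + 3 * d))); last lra.
by rewrite !ger0_norm; lra.
Qed.

Lemma zigzag_window (w d x : R) : 0 < d ->
  w <= x <= w + 3 * d -> w <= zigzag w d x <= w + 3 * d.
Proof.
move=> d0 /andP[wx xw].
have [x1|x1] := leP x (w + d); first by rewrite zigzag_lap1; lra.
have [x2|x2] := leP x (w + 2 * d); first by rewrite zigzag_lap2; lra.
by rewrite zigzag_lap3; lra.
Qed.

Lemma continuous_zigzag (w d : R) : continuous (zigzag w d).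
Proof.
have cn a : continuous (fun x : R => `|x - a|).
  move=> x; apply: (@cvg_norm _ _ _ _ _ (fun y : R => y - a)).
  by apply: cvgB; [exact: cvg_id | exact: cvg_cst].
move=> x; apply: cvgB; last exact: cn.
apply: cvgD; last by apply: cvgM; [exact: cvg_cst | exact: cn].
apply: cvgB; last by apply: cvgM; [exact: cvg_cst | exact: cn].
by apply: cvgD; [exact: cvg_id | exact: cn].
Qed.

Lemma measurable_affine (s t : R) :
  measurable_fun [set: R] (fun x : R => s * x + t).
Proof.
apply: continuous_measurable_fun => x.
apply: cvgD; last exact: cvg_cst.
by apply: cvgM; [exact: cvg_cst | exact: cvg_id].
Qed.

(** The scaled pushforward of Lebesgue measure under the affine map agrees with Lebesgue measure on
    half-open intervals, so uniqueness applies. *)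
Lemma lebesgue_measure_affine (s t : R) (A : set R) : 0 < s -> measurable A ->
  (s%:E * mu ((fun x : R => (s * x + t)%R) @^-1` A))%E = mu A.
Proof.
move=> s0 mA.
have mf : measurable_fun [set: measurableTypeR R]
    ((fun x : R => s * x + t) : measurableTypeR R -> measurableTypeR R).
  exact: measurable_affine.
pose phi : measurableTypeR R -> measurableTypeR R := fun x : R => s * x + t.
pose nu :
    {measure set (measurableTypeR R) -> \bar R} :=
  mscale (NngNum (ltW s0)) (pushforward mu phi).
apply/esym; change (mu A = nu mf A).
apply: (@lebesgue_measure_unique R (nu mf) _ A mA) => _ [[a b]] _ <-.
change (mu `]a, b] = (s%:E * mu (phi @^-1` `]a, b]))%E).
have -> : phi @^-1` `]a, b] = `](a - t) / s, (b - t) / s]%classic.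
  apply/seteqP; split => x /=; rewrite !in_itv/= /phi;
    by rewrite ltr_pdivrMr// ler_pdivlMr//; lra.
rewrite !lebesgue_measure_itv/= !lte_fin ltr_pM2r ?invr_gt0// ltrD2r.
case: ifPn => ab; last by rewrite mule0.
rewrite -!EFinB -EFinM; congr EFin; field.
by rewrite gt_eqF.
Qed.

Lemma lebesgue_measure_affineN (s t : R) (A : set R) : 0 < s -> measurable A ->
  (s%:E * mu ((fun x : R => (- (s * x) + t)%R) @^-1` A))%E = mu A.
Proof.
move=> s0 mA.
have mN : measurable (-%R @^-1` A : set R).
  rewrite -[X in measurable X]setTI.
  by apply: (@oppr_measurable R setT) => //.
rewrite -(lebesgue_measureN mA) /pushforward.
rewrite -(@lebesgue_measure_affine s (- t) (-%R @^-1` A))//.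
congr (_ * mu _)%E; apply/seteqP; split => x /=; by rewrite opprD opprK.
Qed.

(** End points are null. This is needed because a decreasing lap exchanges the two kinds of
    half-open intervals. *)
Lemma lebesgue_measure_setI_co_oc (a b : R) (A : set R) : measurable A ->
  mu (A `&` `[a, b[) = mu (A `&` `]a, b]).
Proof.
move=> mA.
have [ab|ba] := ltP a b; last first.
  by rewrite !set_itv_ge ?bnd_simp// -leNgt.
have z c : mu (A `&` [set c]) = 0%E.
  apply/eqP; rewrite eq_le measure_ge0 andbT -(lebesgue_measure_set1 c).
  by apply: le_measure; rewrite ?inE//; apply: measurableI.
rewrite -(@setU1itv _ _ _ a false) ?bnd_simp//.
rewrite -(@setUitv1 _ _ _ b true) ?bnd_simp// !setIUr !measureU//=; try exact: measurableI.
- by rewrite !z add0e adde0.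
- rewrite -setIIr; apply/seteqP; split => x //=; rewrite in_itv/=.
  by move=> [_ [+ xb]]; rewrite xb ltxx andbF.
- rewrite -setIIr; apply/seteqP; split => x //=; rewrite in_itv/=.
  by move=> [_ [xb]]; rewrite xb ltxx.
Qed.

(** Half-open windows make the four pieces disjoint. The decreasing lap sends its left-closed domain
    to a right-closed window, whence []w, w + 3 * d]]. *)
Lemma zigzag_preimage (w d : R) (A : set R) : 0 < d ->
  zigzag w d @^-1` A =
    ((A `\` `[w, w + 3 * d[)
      `|` (fun x : R => 3 * x + (- (2 * w))) @^-1` (A `&` `[w, w + 3 * d[))
    `|` ((fun x : R => - (3 * x) + (4 * w + 6 * d)) @^-1` (A `&` `]w, w + 3 * d])
      `|` (fun x : R => 3 * x + (- (2 * w) - 6 * d)) @^-1` (A `&` `[w, w + 3 * d[)).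
Proof.
move=> d0; apply/seteqP; split => x /=; rewrite ?in_itv/=.
  move=> Ax.
  have [x0|x0] := ltP x w.
    left; left; rewrite zigzag_out in Ax; [|lra|by left; lra].
    by split => //; lra.
  have [x1|x1] := ltP x (w + d).
    by left; right; rewrite zigzag_lap1 in Ax; [split => //; lra|lra|lra].
  have [x2|x2] := ltP x (w + 2 * d).
    by right; left; rewrite zigzag_lap2 in Ax; [split => //; lra|lra|lra].
  have [x3|x3] := ltP x (w + 3 * d).
    by right; right; rewrite zigzag_lap3 in Ax; [split => //; lra|lra|lra].
  left; left; rewrite zigzag_out in Ax; [|lra|by right; lra].
  by split => //; lra.
move=> [[]|[]] [Ax xw].
- have [?|?] := ltP x w.
    by rewrite zigzag_out//; left; lra.
  rewrite zigzag_out//; right; move: xw; lra.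
- by rewrite zigzag_lap1//; lra.
- by rewrite zigzag_lap2//; lra.
- by rewrite zigzag_lap3//; lra.
Qed.

(** Each of the three full laps has slope 3 in absolute value and contributes a third of the mass of
    [A] in the window. *)
Lemma lebesgue_measure_zigzag (w d : R) (A : set R) : 0 < d -> measurable A ->
  mu (zigzag w d @^-1` A) = mu A.
Proof.
move=> d0 mA.
have mi (P : set R) : measurable P -> measurable (A `&` P) by move=> ?; apply: measurableI.
have mp s t (P : set R) : measurable P -> measurable ((fun x : R => s * x + t) @^-1` P).
  by move=> mP; rewrite -[X in measurable X]setTI; apply: measurable_affine.
have mpN t (P : set R) : measurable P -> measurable ((fun x : R => - (3 * x) + t) @^-1` P).
  move=> mP; rewrite (_ : (fun _ => _) = (fun x : R => - 3 * x + t)); first exact: mp.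
  by apply/funext => x; rewrite mulNr.
have m1 : measurable (A `&` `[w, w + 3 * d[) by apply: mi.
have m2 : measurable (A `&` `]w, w + 3 * d]) by apply: mi.
have mD : measurable (A `\` `[w, w + 3 * d[) by apply: measurableD.
rewrite (zigzag_preimage _ _ d0) measureU; last 3 first.
- by apply: measurableU => //; apply: mp.
- by apply: measurableU; [apply: mpN|apply: mp].
- apply/seteqP; split => x //=; rewrite !in_itv/=.
  by move=> [[[Ax ?]|[? ?]] [[? ?]|[? ?]]]; lra.
rewrite measureU; last 3 first.
- by [].
- exact: mp.
- by apply/seteqP; split => x //=; rewrite !in_itv/=; move=> [[Ax ?] [? ?]]; lra.
rewrite measureU; last 3 first.
- exact: mpN.
- exact: mp.
- by apply/seteqP; split => x //=; rewrite !in_itv/=; move=> [[Ax ?] [? ?]]; lra.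
have inv3 (a m : \bar R) : (3%:E * a)%E = m -> a = ((3^-1)%:E * m)%E.
  by move=> <-; rewrite muleA -EFinM mulVf ?mul1e// gt_eqF.
have lt3 : (0 : R) < 3 by lra.
set m := mu (A `&` `[w, w + 3 * d[).
transitivity (mu (A `\` `[w, (w + 3 * d)%R[) + (3^-1)%:E * m
  + ((3^-1)%:E * m + (3^-1)%:E * m))%E.
  congr (_ + _ + (_ + _))%E; apply: inv3.
  - exact: lebesgue_measure_affine.
  - by rewrite /m (lebesgue_measure_setI_co_oc _ _ mA); exact: lebesgue_measure_affineN.
  - exact: lebesgue_measure_affine.
rewrite -addeA -!ge0_muleDl ?lee_fin ?addr_ge0 ?invr_ge0//.
rewrite -!EFinD (_ : 3^-1 + (3^-1 + 3^-1) = 1 :> R); last by field.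
by rewrite mul1e -measureDI.
Qed.
End ZigzagMeasure.

(** * Continuous measure preserving maps *)

Section MeasurePreserving.
Variable R : realType.
Notation mu := (@lebesgue_measure R).
Implicit Types f g : R -> R.

(** Precomposition with the retraction of the line onto I. A global extension avoids carrying
    subspace continuity through iterates. *)
Lemma continuous_extension f : {within @I01 R, continuous f} ->
  exists2 F : R -> R, continuous F & forall x, I01 x -> F x = f x.
Proof.
move=> cf; pose clamp (x : R) : R := Num.max 0 (Num.min 1 x).
have Iclamp x : I01 (clamp x).
  rewrite /I01 /clamp /= in_itv/= le_max lexx/=.
  by rewrite ge_max ler01 ge_min lexx.
have cclamp : continuous clamp.
  move=> x.
  have c0 (c : R) : {for x, continuous (fun=> c : R^o)} by exact: cvg_cst.
  have cid : {for x, continuous (fun y : R => y : R^o)} by exact: cvg_id.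
  exact: (continuous_max (c0 0) (continuous_min (c0 1) cid)).
exists (f \o clamp) => [x|x]; last first.
  by rewrite /I01 /= in_itv/= /clamp => /andP[x0 x1]; rewrite min_r// max_r.
move=> V /= Vf.
have /subspace_continuousP/(_ _ (Iclamp x)) := cf.
move=> /(_ V Vf) /= wV.
have H : \forall y \near x, I01 (clamp y) -> V (f (clamp y)) := cclamp x _ wV.
change (\forall y \near x, V (f (clamp y))).
by apply: filterS H => y; apply.
Qed.

Lemma continuous_I01 f F : continuous F -> (forall x, I01 x -> F x = f x) ->
  {within @I01 R, continuous f}.
Proof.
move=> cF Ff; apply: (@subspace_eq_continuous _ _ _ F).
  by move=> x; rewrite inE => /Ff.
exact: continuous_subspaceT.
Qed.

Lemma C_lambda_zigzag (w d : R) : 0 < d -> 0 <= w -> w + 3 * d <= 1 ->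
  C_lambda (zigzag w d).
Proof.
move=> d0 w0 w1.
have zI x : I01 (zigzag w d x) <-> I01 x.
  rewrite /I01 /= !in_itv/=.
  have [?|?] := leP x w; first by rewrite zigzag_out//; left.
  have [?|?] := leP x (w + 3 * d); last by rewrite zigzag_out//; right; lra.
  have := @zigzag_window _ w d x d0; split; lra.
split; first by apply: continuous_subspaceT; exact: continuous_zigzag.
split=> [x /zI//|A mA AI].
rewrite setIidr; first exact: lebesgue_measure_zigzag.
by move=> x /= /AI /zI.
Qed.

Lemma C_lambda_id : C_lambda (@id R).
Proof.
split; first by apply: continuous_subspaceT => x; exact: cvg_id.
by split=> // A mA AI; rewrite setIidr.
Qed.

Lemma measurable_I01 : measurable (@I01 R).
Proof. exact: measurable_itv. Qed.

Lemma C_lambda_preimage f (A : set R) : C_lambda f -> measurable A ->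
  measurable (@I01 R `&` f @^-1` A).
Proof.
move=> [cf _] mA.
have mf := subspace_continuous_measurable_fun measurable_I01 cf.
exact: (mf measurable_I01).
Qed.

Lemma C_lambda_comp f g : C_lambda f -> C_lambda g -> C_lambda (f \o g).
Proof.
move=> Cf Cg; have [cf [fI fm]] := Cf; have [cg [gI gm]] := Cg.
split; [|split].
- have [F cF Ff] := continuous_extension cf.
  have [G cG Gg] := continuous_extension cg.
  apply: (@continuous_I01 _ (F \o G)).
    by move=> x; apply: continuous_comp; [exact: cG | exact: cF].
  by move=> x xI /=; rewrite Gg// Ff//; exact: gI.
- by move=> x xI; apply: fI; exact: gI.
- move=> A mA AI.
  (* Off I nothing is known about [f], so the invariance of [g] is applied to the trace on I of the
     preimage. *)
  have sI : @I01 R `&` f @^-1` A `<=` @I01 R by apply: subIsetl.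
  rewrite -(fm _ mA AI) -(gm _ (C_lambda_preimage Cf mA) sI).
  congr (mu _); apply/seteqP; split => x /= [xI] => [fgA|[]//].
  by split => //; split => //; exact: gI.
Qed.

Lemma C_lambda_iter f n : C_lambda f -> C_lambda (iter n f).
Proof.
by move=> Cf; elim: n => [|n IH]; [exact: C_lambda_id | exact: C_lambda_comp].
Qed.

Lemma I01E (x : R) : I01 x <-> 0 <= x <= 1.
Proof. by rewrite /I01 /= in_itv. Qed.

Lemma C_lambda_IVT f (a b u v y : R) : C_lambda f -> 0 <= a -> b <= 1 ->
  a <= u <= b -> a <= v <= b -> f u <= y <= f v ->
  exists2 c, a <= c <= b & f c = y.
Proof.
move=> [cf _] a0 b1 uab vab fy.
have sub (c d : R) : a <= c -> d <= b -> {within `[c, d], continuous f}.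
  move=> ac db; apply: continuous_subspaceW cf => x; rewrite /I01/= !in_itv/=; lra.
have [uv|vu] := leP u v.
  have [||c] := @IVT _ f u v y uv; first by apply: sub; lra.
    by rewrite ge_min le_max; lra.
  by rewrite in_itv/= => ? ?; exists c => //; lra.
have [||c] := @IVT _ f v u y (ltW vu); first by apply: sub; lra.
  by rewrite ge_min le_max; lra.
by rewrite in_itv/= => ? ?; exists c => //; lra.
Qed.

(* A constant value [c] on [a, b] would give the null set [set c] a preimage of
   positive measure. *)
Lemma C_lambda_extrema f (a b : R) : C_lambda f -> 0 <= a -> a < b -> b <= 1 ->
  exists u v : R, [/\ a <= u <= b, a <= v <= b, f u < f v &
    forall x, a <= x <= b -> f u <= f x <= f v].
Proof.
move=> Cf a0 ab b1; have [cf [fI fm]] := Cf.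
have cab : {within `[a, b], continuous f}.
  apply: continuous_subspaceW cf => x; rewrite /I01/= !in_itv/=; lra.
have [u uab umin] := EVT_min (ltW ab) cab.
have [v vab vmax] := EVT_max (ltW ab) cab.
rewrite !in_itv/= in uab vab.
have fuv x : a <= x <= b -> f u <= f x <= f v.
  by move=> xab; rewrite umin ?vmax// in_itv.
exists u, v; split => //.
rewrite lt_neqAle; apply/andP; split; last by have /andP[] := fuv _ vab.
apply/negP => /eqP fuE.
have cst x : a <= x <= b -> f x = f u.
  by move=> /fuv; rewrite -fuE => ?; apply/eqP; rewrite eq_le andbC.
have m1 : measurable [set f u] by exact: measurable_set1.
have sI : [set f u] `<=` @I01 R by move=> _ ->; apply: fI; apply/I01E; lra.
have := fm _ m1 sI; rewrite lebesgue_measure_set1 => m0.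
have : (mu `[a, b] <= mu (@I01 R `&` f @^-1` [set f u]))%E.
  apply: le_measure; rewrite ?inE//; first exact: C_lambda_preimage.
  move=> x /=; rewrite in_itv/= => xab; split; last exact: cst.
  by apply/I01E; lra.
rewrite m0 lebesgue_measure_itv/= lte_fin ab -EFinB lee_fin; lra.
Qed.

(** Heine-Cantor: compactness in near-covering form turns the local moduli at points of I into one
    radius. *)
Lemma C_lambda_uniform f (e : R) : C_lambda f -> 0 < e ->
  exists2 r : R, 0 < r &
    forall x y, I01 x -> I01 y -> `|x - y| < r -> `|f x - f y| < e.
Proof.
move=> [cf _] e0; have [F cF Ff] := continuous_extension cf.
have /compact_near_coveringP := @segment_compact R 0 1.
move=> /(_ R (0^'+) (fun r x => forall y, `|x - y| < r -> `|F x - F y| < e)).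
move=> /(_ _) [].
  move=> x _.
  have /(cvgrPdist_lt _ _).1/(_ (e / 2)) := cF x.
  move=> /(_ _)[]; first lra.
  move=> r /= r0 Hr.
  near=> x' s => y /= xy.
  have h0 : `|x - x'| < r / 2.
    by near: x'; exists (r / 2) => /=; [lra | move=> z].
  have h1 : `|F x - F x'| < e / 2 by apply: Hr => /=; lra.
  have h2 : `|F x - F y| < e / 2.
    apply: Hr => /=.
    have ? : s < r / 2 by near: s; apply: nbhs_right_lt; lra.
    have -> : x - y = (x - x') + (x' - y) by ring.
    by apply: (le_lt_trans (ler_normD _ _)); lra.
  have -> : F x' - F y = (F x - F y) - (F x - F x') by ring.
  by apply: (le_lt_trans (ler_normB _ _)); lra.
move=> r /= r0 Hr.
exists (r / 2); first lra.
move=> x y xI yI xy; rewrite -!Ff//.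
apply: (Hr (r / 2)) => //=; last by lra.
by rewrite sub0r normrN gtr0_norm; lra.
Unshelve. all: by end_near.
Qed.

End MeasurePreserving.

(** * Covering windows and shadowing *)

Section CoveringChains.
Variable R : realType.
Implicit Types F f : R -> R.

Lemma iter_continuous F n : continuous F -> continuous (iter n F).
Proof.
move=> cF; elim: n => [|n IH] x; first exact: cvg_id.
by apply: (@continuous_comp _ _ _ (iter n F) F); [exact: IH | exact: cF].
Qed.

Lemma closed_sublevel F (c : R) : continuous F -> closed [set x | F x <= c].
Proof.
by move=> cF; apply: (@closed_comp _ _ F [set x | x <= c]) => // x _; exact: cF.
Qed.

Lemma closed_superlevel F (c : R) : continuous F -> closed [set x | c <= F x].
Proof.
by move=> cF; apply: (@closed_comp _ _ F [set x | c <= x]) => // x _; exact: cF.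
Qed.

Lemma closed_max (A : set R) (a b x0 : R) : closed A -> A x0 -> a <= x0 <= b ->
  exists p, [/\ A p, a <= p <= b & forall x, A x -> a <= x <= b -> x <= p].
Proof.
move=> cA Ax0 x0ab.
have cS : compact (`[a, b] `&` A) by apply: compact_closedI => //; exact: segment_compact.
have S0 : (`[a, b] `&` A) !=set0 by exists x0; split => //=; rewrite in_itv.
have [|p + pmax] := @compact_EVT_max _ R (fun x => x) _ S0 cS.
  by apply: continuous_subspaceT => x; exact: cvg_id.
rewrite inE /= in_itv/= => -[pab Ap]; exists p; split => // x Ax xab.
by apply: pmax; rewrite inE; split => //=; rewrite in_itv.
Qed.

Lemma closed_min (A : set R) (a b x0 : R) : closed A -> A x0 -> a <= x0 <= b ->
  exists p, [/\ A p, a <= p <= b & forall x, A x -> a <= x <= b -> p <= x].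
Proof.
move=> cA Ax0 x0ab.
have cS : compact (`[a, b] `&` A) by apply: compact_closedI => //; exact: segment_compact.
have S0 : (`[a, b] `&` A) !=set0 by exists x0; split => //=; rewrite in_itv.
have [|p + pmin] := @compact_EVT_min _ R (fun x => x) _ S0 cS.
  by apply: continuous_subspaceT => x; exact: cvg_id.
rewrite inE /= in_itv/= => -[pab Ap]; exists p; split => // x Ax xab.
by apply: pmin; rewrite inE; split => //=; rewrite in_itv.
Qed.

Lemma continuous_IVT F (a b y : R) : continuous F -> a <= b ->
  F a <= y <= F b \/ F b <= y <= F a -> exists2 c, a <= c <= b & F c = y.
Proof.
move=> cF ab Fy.
have [||c] := @IVT _ F a b y ab.
- exact: continuous_subspaceT.
- by rewrite ge_min le_max; lra.
- by rewrite in_itv/= => ? ?; exists c.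
Qed.

(** [p] is the last point of [u, v] with value at most [c], and [q] the first point after [p] with
    value at least [d]. Values in between cannot leave [c, d]. *)
Lemma exact_subinterval_le F (u v c d : R) : continuous F -> u <= v -> c <= d ->
  F u <= c -> d <= F v ->
  exists p q, [/\ u <= p <= v, u <= q <= v, F p = c, F q = d &
    forall x, Num.min p q <= x <= Num.max p q -> c <= F x <= d].
Proof.
move=> cF uv cd Fu Fv.
have [|p [/= Fp puv pmax]] := closed_max (@closed_sublevel F c cF) Fu (_ : u <= u <= v).
  by lra.
have FpE : F p = c.
  have [||s ps Fs] := @continuous_IVT F p v c cF; [lra|lra|].
  have : s <= p by apply: pmax => /=; lra.
  by move=> ?; have -> : p = s by lra.
have [|q [/= Fq qpv qmin]] := closed_min (@closed_superlevel F d cF) Fv (_ : p <= v <= v).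
  by lra.
have FqE : F q = d.
  have [||s ps Fs] := @continuous_IVT F p q d cF; [lra|lra|].
  have : q <= s by apply: qmin => /=; lra.
  by move=> ?; have -> : q = s by lra.
exists p, q; split => //; first lra.
move=> x; rewrite min_l ?max_r; [|lra|lra] => xpq.
apply/andP; split; rewrite leNgt; apply/negP => Fx.
- have : x <= p by apply: pmax => /=; lra.
  move=> xp; have xE : x = p by lra.
  by rewrite xE FpE ltxx in Fx.
- have : q <= x by apply: qmin => /=; lra.
  move=> qx; have xE : x = q by lra.
  by rewrite xE FqE ltxx in Fx.
Qed.

Lemma exact_subinterval F (a b u v c d : R) : continuous F ->
  a <= u <= b -> a <= v <= b -> c <= d -> F u <= c -> d <= F v ->
  exists p q, [/\ a <= p <= b, a <= q <= b, F p = c, F q = d &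
    forall x, Num.min p q <= x <= Num.max p q -> c <= F x <= d].
Proof.
move=> cF uab vab cd Fu Fv.
have [uv|vu] := leP u v.
  have [p [q [pI qI Fp Fq H]]] := exact_subinterval_le cF uv cd Fu Fv.
  by exists p, q; split => //; lra.
have cG : continuous (F \o -%R).
  by move=> x; apply: continuous_comp; [exact: oppr_continuous | exact: cF].
have uv' : - u <= - v by lra.
have [||p [q [pI qI Fp Fq H]]] := @exact_subinterval_le _ (- u) (- v) c d cG uv' cd.
- by rewrite /= opprK.
- by rewrite /= opprK.
exists (- p), (- q); split => //; [lra|lra|].
move=> x; rewrite -oppr_max -oppr_min => xpq.
by have := H (- x); rewrite /= opprK; apply; lra.
Qed.

(** The points [u] and [v] are unordered: the covering may reverse orientation. *)
Definition covers F (l r : nat -> R) := forall n,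
  l n <= r n /\ exists u v, [/\ l n <= u <= r n, l n <= v <= r n,
    F u <= l n.+1 & r n.+1 <= F v].

(** Pull back from the end of the chain: the interval obtained for the tail has an exact preimage
    inside window 0. The exact end values serve the periodic case; [min] and [max] account for
    reversed orientation. *)
Lemma covering_chain F N (l r : nat -> R) : continuous F -> covers F l r ->
  exists a b, [/\ l 0%N <= a <= r 0%N, l 0%N <= b <= r 0%N,
    iter N F a = l N, iter N F b = r N &
    forall x, Num.min a b <= x <= Num.max a b ->
      forall n, (n <= N)%N -> l n <= iter n F x <= r n].
Proof.
move=> cF; elim: N l r => [|N IH] l r cov.
  have [lr _] := cov 0%N.
  exists (l 0%N), (r 0%N); split => //; [lra|lra|].
  move=> x; rewrite min_l// max_r// => xlr n; rewrite leqn0 => /eqP ->.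
  exact: xlr.
have [|a [b [aI bI Fa Fb H]]] := IH (fun n => l n.+1) (fun n => r n.+1).
  by move=> n; exact: cov n.+1.
have [lr [u [v [uI vI Fu Fv]]]] := cov 0%N.
have [ab|ba] := leP a b.
  have [||p [q [pI qI Fp Fq H']]] := exact_subinterval cF uI vI ab; [lra|lra|].
  exists p, q; split => //; rewrite ?iterSr ?Fp ?Fq//.
  move=> x xpq [|n] nN.
    have [//|_] := leP p q; have := xpq; case: (leP p q) => /=; lra.
  by rewrite iterSr; apply: H => //; rewrite (min_l ab) (max_r ab); exact: H'.
have [||p [q [pI qI Fp Fq H']]] := exact_subinterval cF uI vI (ltW ba); [lra|lra|].
exists q, p; split => //; rewrite ?iterSr ?Fp ?Fq//.
move=> x xpq [|n] nN.
  by move: xpq; case: (leP q p) => /=; lra.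
rewrite iterSr; apply: H => //.
by rewrite (min_r (ltW ba)) (max_l (ltW ba)); apply: H'; rewrite minC maxC.
Qed.

(** The points that follow the first N windows have a cluster point in window 0. Each constraint is
    closed and holds for all but finitely many of them, so it passes to the cluster point. *)
Lemma covering_traced F (l r : nat -> R) : continuous F -> covers F l r ->
  exists z, forall n, l n <= iter n F z <= r n.
Proof.
move=> cF cov.
have /choice[z zP] : forall N, exists z, forall n, (n <= N)%N -> l n <= iter n F z <= r n.
  move=> M; have [a [b [_ _ _ _ H]]] := covering_chain M cF cov.
  by exists a; apply: H; rewrite ge_min le_max lexx.
have [|p [_ pz]] := @segment_compact R (l 0%N) (r 0%N) (z @ \oo) _.
  by exists 0%N => // k _ /=; rewrite in_itv/=; exact: (zP k 0%N).
exists p => n.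
have cn := iter_continuous (n:=n) cF.
have cC : closed ([set x | l n <= iter n F x] `&` [set x | iter n F x <= r n]).
  by apply: closedI; [exact: closed_superlevel | exact: closed_sublevel].
apply/andP; apply: cC => V Vp; apply: pz => //.
by exists n => // k /= nk; split; have /andP[] := zP k n nk.
Qed.

(** The N-th iterate sends [a] to [l 0], at most [a], and [b] to [r 0], at least [b], so it has a
    fixed point between them. Times beyond [N] reduce modulo [N]. *)
Lemma covering_periodic_traced F (l r : nat -> R) N : continuous F ->
  covers F l r -> (1 <= N)%N ->
  (forall n, l (n + N)%N = l n) -> (forall n, r (n + N)%N = r n) ->
  exists z, iter N F z = z /\ forall n, l n <= iter n F z <= r n.
Proof.
move=> cF cov N1 lN rN.
have [a [b [aI bI Fa Fb H]]] := covering_chain N cF cov.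
rewrite -[N in l N]add0n lN in Fa; rewrite -[N in r N]add0n rN in Fb.
have [z zab /eqP] : exists2 z, Num.min a b <= z <= Num.max a b & iter N F z - z = 0.
  pose G x := iter N F x - x.
  have cG : continuous G.
    by move=> x; apply: cvgB; [exact: iter_continuous | exact: cvg_id].
  have [ab|ba] := leP a b.
    by apply: (continuous_IVT cG ab); left; rewrite /G Fa Fb; lra.
  by apply: (continuous_IVT cG (ltW ba)); right; rewrite /G Fa Fb; lra.
rewrite subr_eq0 => /eqP zN; exists z; split => // n.
have ziter k m : iter (k * N + m) F z = iter m F z.
  rewrite addnC iterD; congr (iter m F _).
  by elim: k => [//|k IH]; rewrite mulSn iterD IH.
have per (s : nat -> R) : (forall n, s (n + N)%N = s n) ->
    forall k m, s (k * N + m)%N = s m.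
  move=> sN; elim=> [//|k IH] m.
  by rewrite mulSn -addnA addnC sN.
rewrite (divn_eq n N) ziter !per//.
by apply: H => //; apply: ltnW; rewrite ltn_mod.
Qed.

(* The window [l x, r x] need not contain x: this leaves room for the margin
   [delta] even where [f x] is a local extremum. *)
Definition covering_scheme f (eps delta : R) (l r : R -> R) : Prop :=
  (forall x, I01 x ->
    [/\ 0 <= l x, l x <= r x, r x <= 1, x - eps < l x & r x < x + eps]) /\
  (forall x y, I01 x -> I01 y -> `|f x - y| < delta ->
    exists u v, [/\ l x <= u <= r x, l x <= v <= r x,
      f u <= l y - delta & r y + delta <= f v]).

Definition has_covering_scheme (eps : R) : set (R -> R) :=
  [set f | C_lambda f /\
    exists2 delta, 0 < delta & exists l r, covering_scheme f eps delta l r].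

Lemma iter_eq_I01 f F z n : (forall x, I01 x -> I01 (f x)) ->
  (forall x, I01 x -> F x = f x) -> I01 z ->
  iter n F z = iter n f z /\ I01 (iter n f z).
Proof.
move=> fI Ff zI; elim: n => [//|n [IH In]] /=.
by rewrite IH Ff//; split => //; exact: fI.
Qed.

Lemma pseudo_orbit_traced f (eps delta : R) (l r x : _ -> R) F :
  0 < delta -> continuous F -> (forall x, I01 x -> F x = f x) ->
  covering_scheme f eps delta l r -> pseudo_orbit f delta x ->
  covers F (l \o x) (r \o x).
Proof.
move=> d0 cF Ff [scI sc] [xI xd] n /=.
have [l0 lr r1 _ _] := scI _ (xI n).
have [u [v [uI vI fu fv]]] := sc _ _ (xI n) (xI n.+1) (xd n).
split => //; exists u, v; split => //; rewrite Ff; [lra|apply/I01E; lra|lra|apply/I01E; lra].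
Qed.

(** A point whose orbit follows the windows lies in I because window 0 does, and it traces because
    each window lies within [eps] of its point. *)
Lemma covering_scheme_shadowing f (eps delta : R) (l r : R -> R) :
  C_lambda f -> 0 < delta -> covering_scheme f eps delta l r ->
  (forall x, pseudo_orbit f delta x -> exists2 z, I01 z & traces f eps z x) /\
  (forall x, pseudo_orbit f delta x -> periodic_seq x ->
     exists2 z, periodic_point f z & traces f eps z x).
Proof.
move=> Cf d0 sc; have [cf [fI _]] := Cf.
have [F cF Ff] := continuous_extension cf.
have tr x z : pseudo_orbit f delta x ->
    (forall n, l (x n) <= iter n F z <= r (x n)) -> I01 z /\ traces f eps z x.
  move=> [xI _] H.
  have zI : I01 z.
    have := H 0%N; have [? ? ? _ _] := sc.1 _ (xI 0%N) => /= ?.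
    by apply/I01E; lra.
  split => // n; have [<- _] := iter_eq_I01 n fI Ff zI.
  by have := H n; have [_ _ _ ? ?] := sc.1 _ (xI n); rewrite ltr_norml; lra.
split=> [x xo|x xo [N N1 xN]].
  have [z /tr[//|zI ztr]] := covering_traced cF (pseudo_orbit_traced d0 cF Ff sc xo).
  by exists z.
have [||z [zN /tr[//|zI ztr]]] := @covering_periodic_traced F (l \o x) (r \o x) N cF
  (pseudo_orbit_traced d0 cF Ff sc xo) N1.
- by move=> n /=; rewrite xN.
- by move=> n /=; rewrite xN.
exists z => //; split => //; exists N => //.
by have [<- _] := iter_eq_I01 N fI Ff zI.
Qed.

Lemma rho_bounded f g : C_lambda f -> C_lambda g ->
  has_sup [set `|f x - g x| | x in @I01 R].
Proof.
move=> [_ [fI _]] [_ [gI _]]; split.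
  by exists `|f 0 - g 0|, 0 => //; apply/I01E; rewrite lexx ler01.
exists 1 => _ [x xI <-].
have /I01E := fI _ xI; have /I01E := gI _ xI => ? ?.
by rewrite ler_norml; lra.
Qed.

Lemma rho_ge f g (x : R) : C_lambda f -> C_lambda g -> I01 x ->
  `|f x - g x| <= rho f g.
Proof.
by move=> Cf Cg xI; apply: sup_upper_bound; [exact: rho_bounded | exists x].
Qed.

Lemma rho_le f g (e : R) : (forall x, I01 x -> `|f x - g x| <= e) -> rho f g <= e.
Proof.
move=> fg; apply: ge_sup => [|_ [x xI <-]]; last exact: fg.
by exists `|f 0 - g 0|, 0 => //; apply/I01E; rewrite lexx ler01.
Qed.

(** The windows of [f] serve nearby maps too: half of [delta] absorbs the change of map, in the
    closeness condition and in the margin alike. *)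
Lemma open_has_covering_scheme (eps : R) : open_in_Cl (has_covering_scheme eps).
Proof.
split=> [f []//|f [Cf [delta d0 [l [r [scI sc]]]]]].
exists (delta / 2); first lra.
move=> g Cg fg; split => //; exists (delta / 2); first lra.
have close x : I01 x -> - (delta / 2) < f x - g x < delta / 2.
  by move=> /(rho_ge Cf Cg) ?; rewrite -ltr_norml; lra.
exists l, r; split => // x y xI yI; rewrite ltr_norml => gxy.
have [||u [v [uI vI fu fv]]] := sc x y xI => //.
  by have := close x xI; rewrite ltr_norml; lra.
have [? ? ? _ _] := scI x xI.
have uI01 : I01 u by apply/I01E; lra.
have vI01 : I01 v by apply/I01E; lra.
have := close u uI01; have := close v vI01 => cv cu.
by exists u, v; split => //; lra.
Qed.

End CoveringChains.

(** * Zigzags along a grid *)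

Section GridZigzag.
Variable R : realType.
Implicit Types (w d x : R) (t : nat -> R).

(** [phi] inverts the lap containing [x]; every lap is onto the window. *)
Lemma zigzag_inverse_branch w d x : 0 < d -> w <= x <= w + 3 * d ->
  exists phi : R -> R, forall y, w <= y <= w + 3 * d ->
    [/\ w <= phi y <= w + 3 * d, zigzag w d (phi y) = y &
      `|phi y - x| = `|y - zigzag w d x| / 3].
Proof.
move=> d0 xw.
have n3 (z : R) : `|z / 3| = `|z| / 3 by rewrite normrM (gtr0_norm (_ : 0 < 3^-1)).
have [x1|x1] := leP x (w + d).
  exists (fun y => (y + 2 * w) / 3) => y yw; split; first lra.
    by rewrite zigzag_lap1; lra.
  by rewrite -n3 zigzag_lap1; [congr (`|_|); field|lra|lra].
have [x2|x2] := leP x (w + 2 * d).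
  exists (fun y => (4 * w + 6 * d - y) / 3) => y yw; split; first lra.
    by rewrite zigzag_lap2; lra.
  by rewrite -n3 zigzag_lap2; [rewrite distrC; congr (`|_|); field|lra|lra].
exists (fun y => (y + 2 * w + 6 * d) / 3) => y yw; split; first lra.
  by rewrite zigzag_lap3; lra.
by rewrite -n3 zigzag_lap3; [congr (`|_|); field|lra|lra].
Qed.

(** Inverse branches composed along the orbit of [x] shrink the window, of length 3d, by a factor 3
    at each step. *)
Lemma iter_zigzag_near w d x y k : 0 < d ->
  w <= x <= w + 3 * d -> w <= y <= w + 3 * d ->
  exists s, [/\ w <= s <= w + 3 * d, iter k (zigzag w d) s = y &
    `|s - x| <= 3 * d * 3^-1 ^+ k].
Proof.
move=> d0; elim: k x => [|k IH] x xw yw.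
  by exists y; split => //; rewrite expr0 mulr1 ler_norml; lra.
have [s [sw sy sx]] := IH _ (zigzag_window d0 xw) yw.
have [phi /(_ s sw) [pw ps px]] := zigzag_inverse_branch d0 xw.
exists (phi s); split => //; first by rewrite iterSr ps.
by rewrite px exprSr mulrA ler_pM2r.
Qed.

Lemma iter_zigzag_onto w d (a b y : R) : 0 < d ->
  w <= a -> a < b -> b <= w + 3 * d -> w <= y <= w + 3 * d ->
  \forall k \near \oo, exists2 s, a <= s <= b & iter k (zigzag w d) s = y.
Proof.
move=> d0 wa ab bw yw.
have q1 : `|3^-1 : R| < 1 by rewrite gtr0_norm; lra.
(* This threshold makes 3d / 3^k smaller than half of b - a, so a point that close to the midpoint
   lies in [a, b]. *)
have e0 : 0 < (b - a) / (6 * d) by apply: divr_gt0; lra.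
have H : \forall k \near \oo, `|3^-1 ^+ k : R| < (b - a) / (6 * d).
  exact: (cvgr0Pnorm_lt _).1 (cvg_expr q1) _ e0.
apply: filterS H => k; rewrite ger0_norm ?exprn_ge0 ?invr_ge0// => kab.
have xw : w <= (a + b) / 2 <= w + 3 * d by lra.
have [s [sw sy sx]] := iter_zigzag_near k d0 xw yw.
exists s => //.
move: kab; rewrite ltr_pdivlMr; last lra.
by move: sx; rewrite ler_norml; nra.
Qed.

(** A composition of single zigzags, so that preservation of measure is inherited. Windows meet only
    at fixed end points, hence each factor acts on its own window alone. *)
Fixpoint grid_zigzag t n x : R :=
  if n is m.+1 then zigzag (t m) ((t m.+1 - t m) / 3) (grid_zigzag t m x) else x.

Definition grid t n :=
  [/\ t 0%N = 0, t n = 1 & forall j, (j < n)%N -> t j < t j.+1].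

Lemma grid_le t n i j : grid t n -> (i <= j)%N -> (j <= n)%N -> t i <= t j.
Proof.
move=> [_ _ tS]; elim: j => [|j IH]; first by rewrite leqn0 => /eqP ->.
rewrite leq_eqVlt => /orP[/eqP -> //|ij] jn.
by apply: le_trans (IH ij (ltnW jn)) (ltW (tS _ jn)).
Qed.

Lemma grid_I01 t n j : grid t n -> (j <= n)%N -> 0 <= t j <= 1.
Proof.
move=> g jn; have [t0 tn _] := g.
by rewrite -{1}t0 -tn !(grid_le g).
Qed.

Lemma grid_locate_co t n x : grid t n -> 0 <= x < 1 ->
  exists2 j, (j < n)%N & t j <= x < t j.+1.
Proof.
move=> [<- <- _]; elim: n => [|n IH]; first by lra.
move=> x01; have [xn|nx] := ltP x (t n).
  by have [|j jn jx] := IH; [lra | exists j => //; exact: ltnW].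
by exists n => //; lra.
Qed.

Lemma grid_locate_oc t n x : grid t n -> 0 < x <= 1 ->
  exists2 j, (j < n)%N & t j < x <= t j.+1.
Proof.
move=> [<- <- _]; elim: n => [|n IH]; first by lra.
move=> x01; have [xn|nx] := leP x (t n).
  by have [|j jn jx] := IH; [lra | exists j => //; exact: ltnW].
by exists n => //; lra.
Qed.

Lemma grid_locate t n x : grid t n -> I01 x ->
  exists2 j, (j < n)%N & t j <= x <= t j.+1.
Proof.
move=> g /I01E x01; have [x1|x1] := ltP x 1.
  by have [|j jn jx] := grid_locate_co g (_ : 0 <= x < 1); [lra|exists j => //; lra].
by have [|j jn jx] := grid_locate_oc g (_ : 0 < x <= 1); [lra|exists j => //; lra].
Qed.

Lemma C_lambda_grid_zigzag t n m : grid t n -> (m <= n)%N ->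
  C_lambda (grid_zigzag t m).
Proof.
move=> g; elim: m => [|m IH] mn; first exact: C_lambda_id.
have [_ _ /(_ _ mn) tS] := g.
have := grid_I01 g mn; have := grid_I01 g (ltnW mn) => tm tm1.
apply: (@C_lambda_comp _ (zigzag _ _)); last exact/IH/ltnW.
by apply: C_lambda_zigzag; lra.
Qed.

Lemma grid_zigzag_out t n m x : grid t n -> (m <= n)%N -> t m <= x ->
  grid_zigzag t m x = x.
Proof.
move=> g; elim: m => [//|m IH] mn mx /=.
have [_ _ /(_ _ mn) tS] := g.
rewrite IH; [|exact: ltnW|lra].
by rewrite zigzag_out//; [lra|right; lra].
Qed.

(** The earlier factors fix [x], factor [j] keeps it in its window, and the later factors fix the
    result. *)
Lemma grid_zigzag_window t n j x : grid t n -> (j < n)%N ->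
  t j <= x <= t j.+1 -> grid_zigzag t n x = zigzag (t j) ((t j.+1 - t j) / 3) x.
Proof.
move=> g jn jx.
have [_ _ tS] := g; have tj := tS _ jn.
suff H m : (m <= n)%N -> (j < m)%N ->
  grid_zigzag t m x = zigzag (t j) ((t j.+1 - t j) / 3) x by exact: H.
elim: m => [//|m IH] mn; rewrite ltnS leq_eqVlt => /orP[/eqP jm|jm] /=.
  by rewrite -jm (grid_zigzag_out g (ltnW jn)); [|lra].
rewrite (IH (ltnW mn) jm) zigzag_out//; first by have := tS _ mn; lra.
left; have := grid_le g jm (ltnW mn).
have : t j <= zigzag (t j) ((t j.+1 - t j) / 3) x <= t j + 3 * ((t j.+1 - t j) / 3).
  by apply: zigzag_window; lra.
lra.
Qed.

Lemma iter_grid_zigzag t n j x k : grid t n -> (j < n)%N ->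
  t j <= x <= t j.+1 ->
  iter k (grid_zigzag t n) x = iter k (zigzag (t j) ((t j.+1 - t j) / 3)) x /\
  t j <= iter k (grid_zigzag t n) x <= t j.+1.
Proof.
move=> g jn jx; have [_ _ /(_ _ jn) tS] := g.
elim: k => [//|k [IH IHw]] /=.
rewrite {1}(grid_zigzag_window g jn IHw) {1}IH; split => //.
rewrite (grid_zigzag_window g jn IHw).
have : t j <= zigzag (t j) ((t j.+1 - t j) / 3) (iter k (grid_zigzag t n) x)
    <= t j + 3 * ((t j.+1 - t j) / 3).
  by apply: zigzag_window; lra.
lra.
Qed.

Lemma iter_grid_zigzag_fix t n j k : grid t n -> (0 < n)%N -> (j <= n)%N ->
  iter k (grid_zigzag t n) (t j) = t j.
Proof.
move=> g n0 jn; apply: iter_fix; have [_ _ tS] := g.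
move: jn; rewrite leq_eqVlt => /orP[/eqP ->|jn].
  exact: (grid_zigzag_out g).
rewrite (grid_zigzag_window g jn); last by have := tS _ jn; lra.
by rewrite zigzag_out//; [have := tS _ jn; lra | left].
Qed.

Lemma iter_grid_zigzag_ge t n j x k : grid t n -> (j <= n)%N -> I01 x ->
  t j <= x -> t j <= iter k (grid_zigzag t n) x.
Proof.
move=> g jn xI jx; have [m mn mx] := grid_locate g xI.
have n0 : (0 < n)%N by exact: leq_ltn_trans mn.
have [_ ?] := iter_grid_zigzag k g mn mx.
have [jm|mj] := leqP j m; first by have := grid_le g jm (ltnW mn); lra.
(* Here [x] lies in a window to the left of [t j], so [t j <= x] leaves only equality. *)
have tmj := grid_le g mj jn.
have -> : x = t j by lra.
by rewrite (iter_grid_zigzag_fix _ g).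
Qed.

Lemma iter_grid_zigzag_le t n j x k : grid t n -> (j <= n)%N -> I01 x ->
  x <= t j -> iter k (grid_zigzag t n) x <= t j.
Proof.
move=> g jn xI jx; have [m mn mx] := grid_locate g xI.
have n0 : (0 < n)%N by exact: leq_ltn_trans mn.
have [_ ?] := iter_grid_zigzag k g mn mx.
have [mj|jm] := ltnP m j; first by have := grid_le g mj jn; lra.
have tmj := grid_le g jm (ltnW mn).
have -> : x = t j by lra.
by rewrite (iter_grid_zigzag_fix _ g).
Qed.

Lemma iter_grid_zigzag_dist t n x k (L : R) : grid t n ->
  (forall j, (j < n)%N -> t j.+1 - t j <= L) -> I01 x ->
  `|iter k (grid_zigzag t n) x - x| <= L.
Proof.
move=> g tL xI; have [m mn mx] := grid_locate g xI.
have [_ ?] := iter_grid_zigzag k g mn mx.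
by have := tL _ mn; rewrite ler_norml; lra.
Qed.

Lemma iter_grid_zigzag_onto t n j (a b : R) : grid t n -> (j < n)%N ->
  t j <= a -> a < b -> b <= t j.+1 ->
  \forall k \near \oo, exists s s', [/\ a <= s <= b, a <= s' <= b,
    iter k (grid_zigzag t n) s = t j & iter k (grid_zigzag t n) s' = t j.+1].
Proof.
move=> g jn ja ab bj; have [_ _ /(_ _ jn) tS] := g.
have d0 : 0 < (t j.+1 - t j) / 3 by lra.
have bw : b <= t j + 3 * ((t j.+1 - t j) / 3) by lra.
have y1 : t j <= t j <= t j + 3 * ((t j.+1 - t j) / 3) by lra.
have y2 : t j <= t j.+1 <= t j + 3 * ((t j.+1 - t j) / 3) by lra.
near=> k.
have [s sab sj] : exists2 s, a <= s <= b &
    iter k (zigzag (t j) ((t j.+1 - t j) / 3)) s = t j.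
  by near: k; exact: iter_zigzag_onto.
have [s' sab' sj'] : exists2 s, a <= s <= b &
    iter k (zigzag (t j) ((t j.+1 - t j) / 3)) s = t j.+1.
  by near: k; exact: iter_zigzag_onto.
exists s, s'; split => //.
- by rewrite (iter_grid_zigzag k g jn _).1//; lra.
- by rewrite (iter_grid_zigzag k g jn _).1//; lra.
Unshelve. all: by end_near.
Qed.

(** A piece of [a, b] at each end lies in one window; enough iterates spread it over that window, up
    to the outer grid point. Invariance of the windows gives the bounds. *)
Lemma iter_grid_zigzag_interval t n (a b : R) : grid t n -> 0 <= a -> a < b -> b <= 1 ->
  \forall k \near \oo, exists i j s s', [/\ (i < j)%N, (j <= n)%N,
    a <= s <= b /\ a <= s' <= b,
    iter k (grid_zigzag t n) s = t i /\ iter k (grid_zigzag t n) s' = t j &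
    forall x, a <= x <= b -> t i <= iter k (grid_zigzag t n) x <= t j].
Proof.
move=> g a0 ab b1; have [_ _ tS] := g.
(* The half-open choices put [a] strictly below [t i.+1] and [b] strictly above [t j], so both end
   pieces are nondegenerate. *)
have [|i ni ia] := grid_locate_co g (_ : 0 <= a < 1); first by lra.
have [|j nj jb] := grid_locate_oc g (_ : 0 < b <= 1); first by lra.
have ij : (i < j.+1)%N.
  by rewrite ltnNge; apply/negP => ji; have := grid_le g ji (ltnW ni); lra.
near=> k.
have [s [_ [sab _ si _]]] : exists s s', [/\ a <= s <= Num.min b (t i.+1),
    a <= s' <= Num.min b (t i.+1),
    iter k (grid_zigzag t n) s = t i & iter k (grid_zigzag t n) s' = t i.+1].
  near: k; apply: iter_grid_zigzag_onto => //; first lra.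
  - by rewrite lt_min; lra.
  - by rewrite ge_min lexx orbT.
have [_ [s' [_ sab' _ sj]]] : exists s s', [/\ Num.max a (t j) <= s <= b,
    Num.max a (t j) <= s' <= b,
    iter k (grid_zigzag t n) s = t j & iter k (grid_zigzag t n) s' = t j.+1].
  near: k; apply: iter_grid_zigzag_onto => //; last lra.
  - by rewrite le_max lexx orbT.
  - by rewrite gt_max; lra.
exists i, j.+1, s, s'; split => //.
- by move: sab sab'; rewrite le_min ge_max; lra.
- move=> x xab; have xI : I01 x by apply/I01E; lra.
  by rewrite iter_grid_zigzag_ge ?iter_grid_zigzag_le//; [lra|exact: ltnW|lra].
Unshelve. all: by end_near.
Qed.

End GridZigzag.

Lemma eventually_forall_ex (I : finType) (P : I -> nat -> Prop) :
  (forall i, \forall k \near \oo, P i k) -> exists k, forall i, P i k.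
Proof. by move=> /filter_forall /filter_ex. Qed.

(** * Density of maps with covering windows *)

Section Density.
Variable R : realType.
Variables (n : nat) (u : R).

Lemma mesh_gt0 : 6 * n%:R * u = 1 -> 0 < u.
Proof.
move=> u6; rewrite ltNge; apply/negP => ule.
by have nu := mulr_ge0_le0 (ler0n R n) ule; lra.
Qed.

Lemma ler_nat_mesh (i j : nat) : 0 < u -> (i <= j)%N -> i%:R * u <= j%:R * u.
Proof. by move=> u0 ij; rewrite ler_pM2r// ler_nat. Qed.

(* In units of u: 0, 4, 10, 16, ..., 6n - 8, 6n. *)
Definition domain_grid (j : nat) : R :=
  if j == 0%N then 0 else if (j < n)%N then (6 * j%:R - 2) * u else 1.

(* In units of u: 0, 1, 7, 13, ..., 6n - 5, 6n. *)
Definition shifted_grid (j : nat) : R :=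
  if j == 0%N then 0 else if (j <= n)%N then (6 * j%:R - 5) * u else 1.

Definition image_grid (j : nat) : R := 6 * j%:R * u.

Lemma domain_gridS j : (1 < n)%N -> 6 * n%:R * u = 1 -> (j < n)%N ->
  0 <= domain_grid j <= 6 * j%:R * u /\
  (6 * j%:R + 4) * u <= domain_grid j.+1 <= 1 /\
  ((0 < j)%N -> domain_grid j = (6 * j%:R - 2) * u) /\
  domain_grid j.+1 - domain_grid j <= 8 * u.
Proof.
move=> n2 u6; have u0 := mesh_gt0 u6.
move=> jn; rewrite /domain_grid /= jn.
have := ler_nat_mesh u0 jn; rewrite mulrSr => jnu.
case: j jn jnu => [|j] jn jnu /=.
  rewrite n2; split; first lra.
  split; first by have := ler_nat_mesh u0 n2; lra.
  by split => //; lra.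
rewrite mulrSr in jnu *; have j0 : 0 <= j%:R * u by rewrite mulr_ge0 // ltW.
case: ltnP => [jn'|nj].
  have := ler_nat_mesh u0 jn'; rewrite !mulrSr => jnu'.
  split; [lra|split; [lra|split; lra]].
have := ler_nat_mesh u0 nj; rewrite !mulrSr => jnu'.
split; [lra|split; [lra|split; lra]].
Qed.

Lemma grid_domain : (1 < n)%N -> 6 * n%:R * u = 1 -> grid domain_grid n.
Proof.
move=> n2 u6; have u0 := mesh_gt0 u6.
split; first by [].
  by rewrite /domain_grid ltnn; case: eqP => // n0; rewrite n0 in n2.
by move=> j jn; have := domain_gridS n2 u6 jn; lra.
Qed.

Lemma grid_shifted : (1 < n)%N -> 6 * n%:R * u = 1 -> grid shifted_grid n.+1.
Proof.
move=> n2 u6; have u0 := mesh_gt0 u6.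
split; [by []|by rewrite /shifted_grid /= ltnn|].
move=> j jn; rewrite /shifted_grid /=.
case: j jn => [|j] jn /=.
  by rewrite (leq_trans _ n2)//; lra.
rewrite (jn : (j < n)%N); case: ltnP => jn'; rewrite !mulrSr; first lra.
by have := ler_nat_mesh u0 jn; rewrite !mulrSr; lra.
Qed.

Lemma shifted_grid_dist j : (1 < n)%N -> 6 * n%:R * u = 1 -> (j < n.+1)%N ->
  shifted_grid j.+1 - shifted_grid j <= 8 * u.
Proof.
move=> n2 u6; have u0 := mesh_gt0 u6.
move=> jn; rewrite /shifted_grid /=.
case: j jn => [|j] jn /=.
  by rewrite (leq_trans _ n2)//; lra.
rewrite (jn : (j < n)%N); case: ltnP => jn'; rewrite !mulrSr; first lra.
by have := ler_nat_mesh u0 jn'; rewrite !mulrSr; lra.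
Qed.

Lemma grid_image : (1 < n)%N -> 6 * n%:R * u = 1 -> grid image_grid n.
Proof.
move=> n2 u6; have u0 := mesh_gt0 u6.
rewrite /image_grid; split; [by rewrite mulr0 mul0r|lra|].
by move=> j jn; rewrite mulrSr; lra.
Qed.

Local Notation h2 := (grid_zigzag image_grid n).

(* A point of the shifted grid sits at one sixth of a window of [image_grid],
   inside the first of the three laps of [h2]: seen from above it the window is
   folded down to its bottom, seen from below only its lower half is reached. *)
Lemma image_bounds i j : (1 < n)%N -> 6 * n%:R * u = 1 -> (i < j)%N -> (j <= n.+1)%N ->
  exists (a b : nat) (q : R), [/\ (a < n)%N, (b < n)%N,
    q = (6 * b%:R + 3) * u \/ q = 1 /\ b = n.-1,
    (exists y, shifted_grid i <= y <= shifted_grid j /\ h2 y = image_grid a) /\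
    (exists y, shifted_grid i <= y <= shifted_grid j /\ h2 y = q) &
    forall y, shifted_grid i <= y <= shifted_grid j ->
      image_grid a <= h2 y <= q].
Proof.
move=> n2 u6; have u0 := mesh_gt0 u6.
move=> ij jn.
have gI := grid_image n2 u6; have gS := grid_shifted n2 u6.
have n0 : (0 < n)%N by exact: leq_trans n2.
have hfix j0 : (j0 <= n)%N -> h2 (image_grid j0) = image_grid j0.
  exact: (@iter_grid_zigzag_fix _ _ _ j0 1 gI n0).
have hge j0 x : (j0 <= n)%N -> I01 x -> image_grid j0 <= x -> image_grid j0 <= h2 x.
  exact: (@iter_grid_zigzag_ge _ _ _ j0 x 1 gI).
have hle j0 x : (j0 <= n)%N -> I01 x -> x <= image_grid j0 -> h2 x <= image_grid j0.
  exact: (@iter_grid_zigzag_le _ _ _ j0 x 1 gI).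
have inn : (i <= n)%N by rewrite -ltnS; exact: leq_trans ij jn.
have sij := grid_le gS (ltnW ij) jn.
have si := grid_I01 gS (leq_trans inn (leqnSn n)).
have sj := grid_I01 gS jn.
have [a [an alo [ya [yaI hya]]]] : exists a, [/\ (a < n)%N, image_grid a <= shifted_grid i &
    exists y, shifted_grid i <= y <= shifted_grid j /\ h2 y = image_grid a].
  case: i ij inn sij si => [|i] ij inn sij si.
    exists 0%N; split => //; first by rewrite /image_grid /shifted_grid /=; lra.
    exists 0; split; first by rewrite {1}/shifted_grid /=; lra.
    have <- : image_grid 0 = 0 by rewrite /image_grid mulr0 mul0r.
    exact: hfix.
  exists i; split => //.
    by rewrite /image_grid /shifted_grid /= inn mulrSr; lra.
  (* The laps of [h2] have length 2u, so the second one ends 4u above the bottom of the window, with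
     that bottom as value. The next shifted grid point is at least 6u above the bottom. *)
  exists (image_grid i + 4 * u); split.
    rewrite {1}/image_grid {1}/shifted_grid /= inn mulrSr.
    have := grid_le gS ij jn.
    have := ler_nat_mesh u0 inn; rewrite mulrSr {1}/shifted_grid /=.
    by case: ltnP => ?; rewrite ?mulrSr /image_grid; lra.
  have iS : image_grid i.+1 = image_grid i + 6 * u by rewrite /image_grid mulrSr; lra.
  rewrite (grid_zigzag_window gI inn) iS; last lra.
  by rewrite zigzag_lap2; lra.
have [b [q [bn qE [yb [ybI hyb]] hi]]] : exists b q, [/\ (b < n)%N,
    q = (6 * b%:R + 3) * u \/ q = 1 /\ b = n.-1,
    exists y, shifted_grid i <= y <= shifted_grid j /\ h2 y = q &
    forall y, shifted_grid i <= y <= shifted_grid j -> h2 y <= q].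
  have [nj|jn'] := ltnP n j.
    have jE : j = n.+1 by apply/eqP; rewrite eqn_leq jn.
    have [_ sn _] := gS; have [_ i1 _] := gI.
    exists n.-1, 1; split; first by rewrite prednK.
    - by right.
    - exists 1; split; first by rewrite jE sn in sij *; lra.
      by rewrite -{1}i1 hfix.
    - move=> y ysij; rewrite -i1 hle ?i1//.
        by apply/I01E; lra.
      by lra.
  case: j ij jn sij sj yaI jn' => [//|b] ij jn sij sj yaI bn.
  have sb : shifted_grid b.+1 = image_grid b + u.
    by rewrite /shifted_grid /image_grid /= bn mulrSr; lra.
  have iS : image_grid b.+1 = image_grid b + 6 * u by rewrite /image_grid mulrSr; lra.
  (* Slope 3 raises the point lying u above the bottom of window [b] to the middle of the window, 3u
     above the bottom. *)
  exists b, ((6 * b%:R + 3) * u); split => //; first by left.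
    exists (shifted_grid b.+1); split; first lra.
    rewrite (grid_zigzag_window gI bn) iS sb; last lra.
    by rewrite zigzag_lap1 /image_grid; lra.
  move=> y ysij; have yI : I01 y by apply/I01E; lra.
  have [yb|by_] := leP y (image_grid b).
    have := hle _ _ (ltnW bn) yI yb; rewrite {2}/image_grid; lra.
  rewrite (grid_zigzag_window gI bn) iS; last lra.
  by rewrite zigzag_lap1 /image_grid; rewrite ?/image_grid in sb by_ *; lra.
exists a, b, q; split => //; first by split; [exists ya | exists yb].
move=> y ysij; rewrite hi// andbT.
apply: (hge _ _ (ltnW an)); last lra.
by apply/I01E; lra.
Qed.

(** The innermost fold carries each short interval onto its whole window, so the composite attains
    on the short interval all its values on the window. The offsets between the three grids then
    leave the margin [u]. *)
Lemma folded_covering_scheme (f : R -> R) (eps : R) :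
  (1 < n)%N -> 6 * n%:R * u = 1 -> C_lambda f ->
  8 * u < eps ->
  exists k k',
    has_covering_scheme eps
      (h2 \o iter k (grid_zigzag shifted_grid n.+1) \o f \o
       iter k' (grid_zigzag domain_grid n)).
Proof.
move=> n2 u6; have u0 := mesh_gt0 u6.
move=> Cf ueps; have gD := grid_domain n2 u6.
have gS := grid_shifted n2 u6; have gI := grid_image n2 u6.
have [k' Hk'] : exists k', forall i : 'I_n, exists s s',
    [/\ (6 * i%:R + 1) * u <= s <= (6 * i%:R + 2) * u,
      (6 * i%:R + 1) * u <= s' <= (6 * i%:R + 2) * u,
      iter k' (grid_zigzag domain_grid n) s = domain_grid i &
      iter k' (grid_zigzag domain_grid n) s' = domain_grid i.+1].
  apply: eventually_forall_ex => i.
  have := domain_gridS n2 u6 (ltn_ord i) => ?.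
  by apply: iter_grid_zigzag_onto => //; lra.
(* Each f(W_i) is nondegenerate, so iterates of the zigzag on the shifted grid can spread it. *)
have /choice[mn mnP] : forall i : 'I_n, exists p : R * R,
    [/\ domain_grid i <= p.1 <= domain_grid i.+1,
      domain_grid i <= p.2 <= domain_grid i.+1, f p.1 < f p.2 &
      forall x, domain_grid i <= x <= domain_grid i.+1 -> f p.1 <= f x <= f p.2].
  move=> i; have := domain_gridS n2 u6 (ltn_ord i) => ?.
  have [|||x [y H]] := @C_lambda_extrema _ f (domain_grid i) (domain_grid i.+1) Cf; try lra.
  by exists (x, y).
have [_ [fI _]] := Cf.
have [k Hk] : exists k, forall i : 'I_n, exists a b s s', [/\ (a < b)%N, (b <= n.+1)%N,
    f (mn i).1 <= s <= f (mn i).2 /\ f (mn i).1 <= s' <= f (mn i).2,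
    iter k (grid_zigzag shifted_grid n.+1) s = shifted_grid a /\
    iter k (grid_zigzag shifted_grid n.+1) s' = shifted_grid b &
    forall x, f (mn i).1 <= x <= f (mn i).2 ->
      shifted_grid a <= iter k (grid_zigzag shifted_grid n.+1) x <= shifted_grid b].
  apply: eventually_forall_ex => i.
  have [p1 p2 p12 _] := mnP i; have := domain_gridS n2 u6 (ltn_ord i) => ?.
  have /fI/I01E ? : I01 (mn i).1 by apply/I01E; lra.
  have /fI/I01E ? : I01 (mn i).2 by apply/I01E; lra.
  by apply: iter_grid_zigzag_interval => //; lra.
exists k, k'.
set h := iter k' _; set h1 := iter k _; set g := h2 \o _ \o _ \o _.
have Ch : C_lambda h by apply: C_lambda_iter; exact: (C_lambda_grid_zigzag gD).
have Ch1 : C_lambda h1 by apply: C_lambda_iter; exact: (C_lambda_grid_zigzag gS).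
have Ch2 : C_lambda h2 by exact: (C_lambda_grid_zigzag gI).
have Cg : C_lambda g by do 3 (apply: C_lambda_comp => //).
split => //; exists u => //.
have n0 : (0 < n)%N by exact: leq_trans n2.
have /choice[idx idxP] : forall x : R, exists i : 'I_n,
    I01 x -> domain_grid i <= x <= domain_grid i.+1.
  move=> x.
  have [xI|xI] := pselect (I01 x); last by exists (Ordinal n0).
  by have [j jn jx] := grid_locate gD xI; exists (Ordinal jn).
exists (fun x => (6 * (idx x)%:R + 1) * u), (fun x => (6 * (idx x)%:R + 2) * u).
split=> [x xI|x y xI yI gxy].
  have := domain_gridS n2 u6 (ltn_ord (idx x)); have := idxP x xI => ? ?.
  by split; lra.
have := idxP x xI; set i := idx x => xi.
have := domain_gridS n2 u6 (ltn_ord i) => Di.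
have [a [b [s [s' [ab bn [sI sI'] [h1s h1s'] h1I]]]]] := Hk i.
have [p [q [qv [pn qn qE [[yp [ypI hyp]] [yq [yqI hyq]]] hpq]]]] := image_bounds n2 u6 ab bn.
have [m1 m2 m12 mm] := mnP i.
have /andP[lo0 _] : 0 <= f (mn i).1 <= 1.
  by apply/I01E/fI/I01E; move: m1 Di; clear; lra.
have /andP[_ hi1] : 0 <= f (mn i).2 <= 1.
  by apply/I01E/fI/I01E; move: m2 Di; clear; lra.
have D0 : 0 <= domain_grid i by move: Di; clear; lra.
have D1 : domain_grid i.+1 <= 1 by move: Di; clear; lra.
have K0 : 0 <= (6 * i%:R + 1) * u by move: u0 Di; clear; lra.
have K1 : (6 * i%:R + 2) * u <= 1 by move: u0 Di; clear; lra.
(* Points of [h1 (f W_i)] have preimages under [h1 \o f \o h] in the short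
   interval. *)
have lift z : shifted_grid a <= z <= shifted_grid b ->
    exists2 v, (6 * i%:R + 1) * u <= v <= (6 * i%:R + 2) * u & h1 (f (h v)) = z.
  move=> zab.
  have z_h1 : h1 s <= z <= h1 s' by rewrite /h1 h1s h1s'.
  have [z1 z1I <-] := C_lambda_IVT Ch1 lo0 hi1 sI sI' z_h1.
  have [z2 z2I <-] := C_lambda_IVT Cf D0 D1 m1 m2 z1I.
  have [v [v' [vI vI' hv hv']]] := Hk' i.
  have z2_h : h v <= z2 <= h v' by rewrite /h hv hv'.
  by have [z3 z3I <-] := C_lambda_IVT Ch K0 K1 vI vI' z2_h; exists z3.
have [v vI hv] := lift _ ypI; have [v' vI' hv'] := lift _ yqI.
exists v, v'; split => //; rewrite /g /= ?hv ?hv' ?hyp ?hyq.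
all: have gx : image_grid p <= g x <= qv.
all: try (rewrite /g /=; apply/hpq/h1I/mm; exact: (iter_grid_zigzag k' gD _ xi).2).
all: have yj := idxP y yI; have := domain_gridS n2 u6 (ltn_ord (idx y)) => Dj.
all: move: gxy; rewrite ltr_norml => gxy.
(* If the index of [y] were below [p], then [y] would be at most (6p - 2) u while [g x] is at least
   6p u: too far apart. *)
- have pj : (p <= idx y)%N.
    rewrite leqNgt; apply/negP => jp.
    have := grid_le gD jp (ltnW pn).
    have [_ [_ [+ _]]] := domain_gridS n2 u6 pn.
    move=> /(_ (leq_trans (ltn0Sn _) jp)) ->.
    by move: gx; rewrite /image_grid; lra.
  by have := ler_nat_mesh u0 pj; rewrite /image_grid; lra.
(* For [qv = 1] the bound follows from [idx y < n]. Otherwise an index above [q] would put [y] at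
   (6q + 4) u or higher and [g x] at (6q + 3) u or lower, against a distance strictly below [u]. *)
- case: qE => [qE|[-> _]]; last first.
    by have := ler_nat_mesh u0 (ltn_ord (idx y)); rewrite mulrSr; lra.
  have qj : (idx y <= q)%N.
    rewrite leqNgt; apply/negP => qj.
    have := grid_le gD qj (ltnW (ltn_ord (idx y))).
    have [_ [+ _]] := domain_gridS n2 u6 qn.
    by lra.
  by have := ler_nat_mesh u0 qj; lra.
Qed.

(** The inner fold moves points by at most 8u < r, hence values of [f] by less than [e]; each of the
    two outer folds adds at most 8u. *)
Lemma folded_dist (f : R -> R) (r e : R) k k' :
  (1 < n)%N -> 6 * n%:R * u = 1 -> C_lambda f ->
  8 * u < r ->
  (forall x y, I01 x -> I01 y -> `|x - y| < r -> `|f x - f y| < e) ->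
  rho f (h2 \o iter k (grid_zigzag shifted_grid n.+1) \o f \o
       iter k' (grid_zigzag domain_grid n)) <= e + 16 * u.
Proof.
move=> n2 u6; have u0 := mesh_gt0 u6.
move=> [_ [fI _]] ur fr; have gD := grid_domain n2 u6.
have gS := grid_shifted n2 u6; have gI := grid_image n2 u6.
apply: rho_le => x xI /=.
have Dd j : (j < n)%N -> domain_grid j.+1 - domain_grid j <= 8 * u.
  by move=> /(domain_gridS n2 u6); lra.
have Id j : (j < n)%N -> image_grid j.+1 - image_grid j <= 8 * u.
  by move=> jn; rewrite /image_grid mulrSr; lra.
have d1 := iter_grid_zigzag_dist k' gD Dd xI.
have [_ [hI _]] := C_lambda_iter k' (C_lambda_grid_zigzag gD (leqnn n)).
have [_ [h1I _]] := C_lambda_iter k (C_lambda_grid_zigzag gS (leqnn n.+1)).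
have d2 := iter_grid_zigzag_dist k gS (fun j => @shifted_grid_dist j n2 u6) (fI _ (hI _ xI)).
have d3 := iter_grid_zigzag_dist 1 gI Id (h1I _ (fI _ (hI _ xI))).
have d4 : `|f x - f (iter k' (grid_zigzag domain_grid n) x)| < e.
  by apply: fr => //; [exact: hI | rewrite distrC; lra].
move: d2 d3 d4; rewrite /= !ler_norml !ltr_norml; lra.
Qed.

End Density.


(** * Density in the uniform metric and the residual set *)

Section Genericity.
Variable R : realType.

Lemma dense_has_covering_scheme (eps : R) : 0 < eps ->
  dense_in_Cl (has_covering_scheme eps).
Proof.
move=> eps0 f Cf e e0.
have e2 : 0 < e / 2 by lra.
have [r r0 fr] := C_lambda_uniform Cf e2.
(* [eta] meets three demands: windows small against [eps], oscillation of [f] below e / 2, and outer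
   folds moving points by less than e / 2 in total. *)
pose eta := Num.min eps (Num.min r (e / 2)).
have eta4 : 0 < eta / 4 by rewrite divr_gt0// !lt_min; lra.
have : eta <= eps /\ eta <= r /\ eta <= e / 2 by rewrite !ge_min !lexx !orbT.
move=> [eeps [er ee]].
move: eta eta4 eeps er ee => eta eta4 eeps er ee.
(* The mesh uses n = m + 2, which ensures 1 < n; then u = 1 / (6n) gives 16u < eta because 16 / 6 <
   4. *)
have [m] := ltr_add_invr eta4.
rewrite add0r => meta.
pose u : R := (6 * m.+2%:R)^-1.
have u6 : 6 * m.+2%:R * u = 1 by rewrite divff// mulf_neq0// pnatr_eq0.
have ueta : 16 * u < eta.
  have v2 : m.+2%:R^-1 <= m.+1%:R^-1 :> R by rewrite lef_pV2 ?posrE// ler_nat.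
  have v0 : 0 < m.+2%:R^-1 :> R by rewrite invr_gt0.
  have -> : u = 6^-1 * m.+2%:R^-1 by rewrite /u invfM.
  by move: v2 v0 meta; move: m.+2%:R^-1 m.+1%:R^-1 => a b; lra.
have u0 := mesh_gt0 u6.
have ueps : 8 * u < eps by lra.
have ur : 8 * u < r by lra.
have [k [k' sc]] := @folded_covering_scheme _ m.+2 u f eps isT u6 Cf ueps.
exists (grid_zigzag (image_grid u) m.+2 \o
  iter k (grid_zigzag (shifted_grid m.+2 u) m.+3) \o f \o
  iter k' (grid_zigzag (domain_grid m.+2 u) m.+2)) => //.
have := @folded_dist _ m.+2 u f r (e / 2) k k' isT u6 Cf ur fr; lra.
Qed.

End Genericity.

Theorem theorem1p3 (R : realType) :
  exists G : set (R -> R), residual_in_Cl G /\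
    (forall f, G f -> shadowing f /\ periodic_shadowing f).
Proof.
(* The values 1 / (n + 1) of [eps] make the intersection countable and suffice for every positive
   [eps]; one [delta] serves both kinds of shadowing. *)
pose U (n : nat) := has_covering_scheme (n.+1%:R^-1 : R).
exists (\bigcap_n U n); split.
  split; first by move=> f /(_ 0%N I) [].
  exists U; split; [|split] => // n; first exact: open_has_covering_scheme.
  by apply: dense_has_covering_scheme; rewrite invr_gt0.
move=> f Uf.
have small (eps : R) : 0 < eps -> exists2 delta, 0 < delta &
    (forall x, pseudo_orbit f delta x -> exists2 z, I01 z & traces f eps z x) /\
    (forall x, pseudo_orbit f delta x -> periodic_seq x ->
       exists2 z, periodic_point f z & traces f eps z x).
  move=> eps0; have [n] := ltr_add_invr eps0; rewrite add0r => neps.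
  have [Cf [delta d0 [l [r sc]]]] := Uf n I.
  have [sh psh] := covering_scheme_shadowing Cf d0 sc.
  have tr z x : traces f n.+1%:R^-1 z x -> traces f eps z x.
    by move=> H k; exact: lt_trans (H k) neps.
  exists delta => //; split=> x.
    by move=> /sh[z zI /tr]; exists z.
  by move=> xo /(psh _ xo)[z zI /tr]; exists z.
by split=> eps /small[delta d0 [sh psh]]; exists delta.
Qed.
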